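(* Let $N\ge1$, $h,l>0$, $(\alpha,\beta)\in\mathbb R^2\setminus\{(0,0)\}$ and $\theta\in\mathbb R^3$ with $\theta_1\theta_2\theta_3\ne0$. For the $N$-resonator system described in the context, with vertex conditions of type I or of type II, the transmission probability $T(k)=T(k;\theta_1,\theta_2,\theta_3)$ is an even function of each $\theta_j$ separately: for every $k>0$ and every choice of the three signs, $$T(k;\pm\theta_1,\pm\theta_2,\pm\theta_3)=T(k;\theta_1,\theta_2,\theta_3).$$
   Context: Model. The metric graph $G$ has vertices $v_1,\dots,v_N$ of degree 3, placed on the real line (the channel) at $x_j=(j-1)h$, and vertices $u_1,\dots,u_N$ of degree 1. The channel consists of the leads $e_{in}=(-\infty,0]$ (ending at $v_1$), $e_{out}=[(N-1)h,+\infty)$ (starting at $v_N$), and the segments of length $h$ between consecutive $v_j$'s. At each $v_j$ a resonator edge $(v_j,u_j)$ of length $l$ is attached, with coordinate $s\in[0,l]$, $s=0$ at $v_j$ and $s=l$ at $u_j$. At $v=v_j$, $\psi_1(v),\psi_2(v),\psi_3(v)$ denote the limits of $\psi$ at $v$ along the left channel edge, the right channel edge and the resonator edge, and $\psi_i'(v)$ the corresponding one-sided derivatives taken in the direction from $v$ into the edge. Vertex conditions at every $v_j$. Type I: $\frac{\psi_1(v)}{\theta_1}=\frac{\psi_2(v)}{\theta_2}=\frac{\psi_3(v)}{\theta_3}$ and $\theta_1\psi_1'(v)+\theta_2\psi_2'(v)+\theta_3\psi_3'(v)=0$. Type II: $\frac{\psi_1'(v)}{\theta_1}=\frac{\psi_2'(v)}{\theta_2}=\frac{\psi_3'(v)}{\theta_3}$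 and $\theta_1\psi_1(v)+\theta_2\psi_2(v)+\theta_3\psi_3(v)=0$. Endpoint condition at each $u_j$: $\alpha\psi+\beta\frac{d\psi}{ds}=0$ at $s=l$. Scattering solution at wavenumber $k>0$: a function $\psi$ on $G$ with $\psi''+k^2\psi=0$ on every edge, satisfying all vertex and endpoint conditions, with $\psi(x)=e^{ikx}+r(k)e^{-ikx}$ on $e_{in}$ and $\psi(x)=t(k)e^{ikx}$ on $e_{out}$. The amplitudes are uniquely determined; the transmission probability is $T(k)=|t(k)|^2$. All parameters other than those displayed in $T(k;\theta_1,\theta_2,\theta_3)$, and the type of vertex conditions, are kept fixed. *)

(* Defs.v *)
From Stdlib Require Import Reals Lra Lia Psatz.
From Coquelicot Require Import Coquelicot.
Open Scope R_scope.

Inductive vertex_type : Set := TypeI | TypeII.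

(* e^{ix} *)
Definition expi (x : R) : C := (cos x, sin x).

(* A function on an edge is a function [R -> C] of the coordinate on that
   edge, looked at on the interior of the edge only.  Let [g tau] be such a
   function at distance [tau > 0] from an end of the edge.  [boundary_values g
   p d]: at this end the function has the limit [p] along the edge and the
   one-sided derivative [d] in the direction pointing into the edge. *)
Definition boundary_values (g : R -> C) (p d : C) : Prop :=
  filterlim g (at_right 0) (locally p) /\
  filterlim (fun tau : R => ((g tau - p) / RtoC tau)%C) (at_right 0) (locally d).

(* f'' + k^2 f = 0 on D *)
Definition helmholtz (k : R) (D : R -> Prop) (f : R -> C) : Prop :=
  exists df : R -> C, forall x : R, D x ->
    is_derive (V := C_R_NormedModule) f x (df x) /\
    is_derive (V := C_R_NormedModule) df x (- (RtoC (k ^ 2) * f x))%C.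

(* [p1 p2 p3] are the limits and [d1 d2 d3] the inward derivatives on the left
   channel edge, the right channel edge and the resonator edge. *)
Definition vertex_condition (ty : vertex_type) (th1 th2 th3 : R)
    (p1 p2 p3 d1 d2 d3 : C) : Prop :=
  match ty with
  | TypeI =>
      (p1 / RtoC th1 = p2 / RtoC th2)%C /\ (p2 / RtoC th2 = p3 / RtoC th3)%C /\
      (RtoC th1 * d1 + RtoC th2 * d2 + RtoC th3 * d3 = 0)%C
  | TypeII =>
      (d1 / RtoC th1 = d2 / RtoC th2)%C /\ (d2 / RtoC th2 = d3 / RtoC th3)%C /\
      (RtoC th1 * p1 + RtoC th2 * p2 + RtoC th3 * p3 = 0)%C
  end.

(* Position of v_j, for 1 <= j <= N. *)
Definition vertex_pos (h : R) (j : nat) : R := (INR j - 1) * h.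

(* The N + 1 open channel edges, for 0 <= j <= N: edge 0 is the incoming lead,
   edge N the outgoing lead, and edge j joins v_j to v_{j+1} otherwise. *)
Definition channel_edge (N : nat) (h : R) (j : nat) (x : R) : Prop :=
  ((1 <= j)%nat -> vertex_pos h j < x) /\ ((j < N)%nat -> x < vertex_pos h (S j)).

(* A function on the graph: [channel psi j] lives on the j-th channel edge
   (0 <= j <= N) and [resonator psi j] on the edge (v_j, u_j) (1 <= j <= N).
   Separate functions are needed because the channel function may jump at the
   vertices. *)
Record graph_function := GraphFunction {
  channel : nat -> R -> C;
  resonator : nat -> R -> C }.

Definition scattering_solution (ty : vertex_type) (N : nat) (h l alpha beta : R)
    (th1 th2 th3 k : R) (psi : graph_function) (r t : C) : Prop :=
  (forall j, (j <= N)%nat -> helmholtz k (channel_edge N h j) (channel psi j)) /\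
  (forall j, (1 <= j <= N)%nat ->
     helmholtz k (fun s => 0 < s < l) (resonator psi j)) /\
  (forall j, (1 <= j <= N)%nat ->
     exists p1 p2 p3 d1 d2 d3 : C,
       boundary_values
         (fun tau => channel psi (pred j) (vertex_pos h j - tau)) p1 d1 /\
       boundary_values (fun tau => channel psi j (vertex_pos h j + tau)) p2 d2 /\
       boundary_values (fun tau => resonator psi j tau) p3 d3 /\
       vertex_condition ty th1 th2 th3 p1 p2 p3 d1 d2 d3) /\
  (* [d] points from u_j into the resonator, so dpsi/ds = - d *)
  (forall j, (1 <= j <= N)%nat ->
     exists p d : C,
       boundary_values (fun tau => resonator psi j (l - tau)) p d /\
       (RtoC alpha * p + RtoC beta * (- d) = 0)%C) /\
  (forall x, channel_edge N h 0 x ->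
     channel psi 0 x = (expi (k * x) + r * expi (- (k * x)))%C) /\
  (forall x, channel_edge N h N x -> channel psi N x = (t * expi (k * x))%C).

Definition is_transmission_amplitude (ty : vertex_type) (N : nat)
    (h l alpha beta th1 th2 th3 k : R) (t : C) : Prop :=
  exists (psi : graph_function) (r : C),
    scattering_solution ty N h l alpha beta th1 th2 th3 k psi r t.

(* [iota P] is the unique element satisfying [P]; existence and uniqueness of
   the amplitude is [transmission_amplitude_unique_existence] below. *)
Definition transmission_amplitude (ty : vertex_type) (N : nat)
    (h l alpha beta th1 th2 th3 k : R) : C :=
  iota (T := C_CompleteNormedModule)
    (is_transmission_amplitude ty N h l alpha beta th1 th2 th3 k).

Definition transmission_probability (ty : vertex_type) (N : nat)
    (h l alpha beta th1 th2 th3 k : R) : R :=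
  Cmod (transmission_amplitude ty N h l alpha beta th1 th2 th3 k) ^ 2.

Lemma is_derive_C (f : R -> C) (x : R) (u : C) :
  is_derive (V := C_R_NormedModule) f x u <->
  is_derive (fun y => fst (f y)) x (fst u) /\
  is_derive (fun y => snd (f y)) x (snd u).
Proof.
split.
- intros H; split.
  + apply (filterdiff_ext_lin _ (fun y : R => fst (scal y u : C))).
    2: reflexivity.
    apply (filterdiff_comp' (V := C_R_NormedModule) f
      (fun t : C_R_NormedModule => fst t)); [exact H|].
    apply filterdiff_linear. exact is_linear_fst.
  + apply (filterdiff_ext_lin _ (fun y : R => snd (scal y u : C))).
    2: reflexivity.
    apply (filterdiff_comp' (V := C_R_NormedModule) f
      (fun t : C_R_NormedModule => snd t)); [exact H|].
    apply filterdiff_linear. exact is_linear_snd.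
- intros [H1 H2].
  apply (filterdiff_ext (V := C_R_NormedModule) (fun y => (fst (f y), snd (f y)) : C)).
  { intros y; symmetry; apply surjective_pairing. }
  apply (filterdiff_ext_lin (V := C_R_NormedModule) _
    (fun y : R => (scal y (fst u) : R, scal y (snd u) : R) : C)).
  2: reflexivity.
  apply (filterdiff_comp'_2 (W := C_R_NormedModule)
    (fun y => fst (f y)) (fun y => snd (f y)) (fun a b => (a, b) : C) x
    (fun y => scal y (fst u)) (fun y => scal y (snd u)) (fun a b => (a, b) : C) H1 H2).
  apply (filterdiff_ext (V := C_R_NormedModule) (fun t : R * R => t)).
  { intros t; apply surjective_pairing. }
  apply (filterdiff_ext_lin (V := C_R_NormedModule) _ (fun t : R * R => t)).
  2: intros t; apply surjective_pairing.
  apply filterdiff_id.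
Qed.

Lemma Cdiv_R (z : C) (x : R) : x <> 0 -> (z / RtoC x)%C = (fst z / x, snd z / x).
Proof.
intros Hx; destruct z as [a b]; unfold Cdiv, Cinv, Cmult, RtoC; simpl.
f_equal; field; nra.
Qed.

Lemma ball_0 (eps y : R) : ball (0 : R) eps y -> Rabs y < eps.
Proof.
intros H; change (Rabs (y + - 0) < eps) in H.
now rewrite Ropp_0, Rplus_0_r in H.
Qed.

Lemma difference_quotient_right (f : R -> R) (d : R) :
  is_derive f 0 d ->
  filterlim (fun tau => (f tau - f 0) / tau) (at_right 0) (locally d).
Proof.
intros H; apply is_derive_Reals in H.
intros P [eps HP].
destruct (H eps (cond_pos eps)) as [del Hd].
exists del; intros y Hy Hy0.
apply HP.
specialize (Hd y (Rgt_not_eq _ _ Hy0) (ball_0 _ _ Hy)).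
now rewrite Rplus_0_l in Hd.
Qed.

Lemma filterlim_C (F : (R -> Prop) -> Prop) {FF : Filter F} (f : R -> C) (u : C) :
  filterlim (fun x => fst (f x)) F (locally (fst u)) ->
  filterlim (fun x => snd (f x)) F (locally (snd u)) ->
  filterlim f F (locally u).
Proof.
intros H1 H2 P [eps HP].
specialize (H1 _ (locally_ball (fst u) eps)).
specialize (H2 _ (locally_ball (snd u) eps)).
unfold filtermap in *.
generalize (filter_and _ _ H1 H2); apply filter_imp.
intros x [A B]; apply HP; split; assumption.
Qed.

Lemma at_right_pos : at_right 0 (fun tau => 0 < tau).
Proof. exists (mkposreal 1 Rlt_0_1); intros y _ Hy; exact Hy. Qed.

Lemma at_right_lt (del : R) : 0 < del -> at_right 0 (fun tau => 0 < tau < del).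
Proof.
intros Hd; exists (mkposreal del Hd); intros y Hb Hy; split; [exact Hy|].
apply ball_0, Rabs_def2 in Hb; exact (proj1 Hb).
Qed.

Lemma boundary_values_derive (g : R -> C) (u : C) :
  is_derive (V := C_R_NormedModule) g 0 u -> boundary_values g (g 0) u.
Proof.
intros H; split.
- assert (Q : filterlim g (locally 0) (locally (g 0))).
  { apply (ex_derive_continuous (V := C_R_NormedModule) g 0); now exists u. }
  intros P HP; destruct (Q P HP) as [del Hd]; exists del; intros y Hy _.
  now apply Hd.
- apply is_derive_C in H; destruct H as [H1 H2].
  apply (filterlim_C (at_right 0)).
  + refine (filterlim_ext_loc (F := at_right 0)
      (fun tau => (fst (g tau) - fst (g 0)) / tau) _ _
      (difference_quotient_right (fun y => fst (g y)) _ _)); [|assumption].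
    generalize at_right_pos; apply filter_imp; intros y Hy.
    rewrite Cdiv_R by lra. reflexivity.
  + refine (filterlim_ext_loc (F := at_right 0)
      (fun tau => (snd (g tau) - snd (g 0)) / tau) _ _
      (difference_quotient_right (fun y => snd (g y)) _ _)); [|assumption].
    generalize at_right_pos; apply filter_imp; intros y Hy.
    rewrite Cdiv_R by lra. reflexivity.
Qed.

Lemma boundary_values_ext (del : R) (f g : R -> C) (p d : C) :
  0 < del -> (forall tau, 0 < tau < del -> f tau = g tau) ->
  boundary_values f p d -> boundary_values g p d.
Proof.
intros Hd E [H1 H2]; split.
- revert H1; apply filterlim_ext_loc.
  generalize (at_right_lt del Hd); apply filter_imp; exact E.
- revert H2; apply filterlim_ext_loc.
  generalize (at_right_lt del Hd); apply filter_imp.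
  intros y Hy; now rewrite E.
Qed.

Lemma boundary_values_unique (g : R -> C) (p d p' d' : C) :
  boundary_values g p d -> boundary_values g p' d' -> p = p' /\ d = d'.
Proof.
intros [H1 H2] [H1' H2'].
assert (p = p') by
  exact (filterlim_locally_unique (V := C_R_NormedModule) _ _ _ H1 H1').
subst p'; split; [reflexivity|].
exact (filterlim_locally_unique (V := C_R_NormedModule) _ _ _ H2 H2').
Qed.

(* The general solution of the Helmholtz equation, and its derivative. *)
Definition cwave (k : R) (a b : C) (x : R) : C :=
  (a * expi (k * x) + b * expi (- (k * x)))%C.

Definition dwave (k : R) (a b : C) (x : R) : C :=
  (Ci * RtoC k * (a * expi (k * x) - b * expi (- (k * x))))%C.

Lemma is_derive_cwave k a b x :
  is_derive (V := C_R_NormedModule) (cwave k a b) x (dwave k a b x).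
Proof.
apply is_derive_C; destruct a as [a1 a2], b as [b1 b2].
unfold cwave, dwave, expi, Cplus, Cminus, Copp, Cmult, Ci, RtoC; simpl; split.
- auto_derive; [exact I|]. ring.
- auto_derive; [exact I|]. ring.
Qed.

Lemma dwave_cwave k a b :
  dwave k a b = cwave k (Ci * RtoC k * a) (- (Ci * RtoC k * b)).
Proof.
apply FunctionalExtensionality.functional_extensionality; intros x.
unfold dwave, cwave; ring.
Qed.

Lemma is_derive_dwave k a b x :
  is_derive (V := C_R_NormedModule) (dwave k a b) x
    (- (RtoC (k ^ 2) * cwave k a b x))%C.
Proof.
rewrite dwave_cwave.
replace (- (RtoC (k ^ 2) * cwave k a b x))%C
  with (dwave k (Ci * RtoC k * a) (- (Ci * RtoC k * b)) x).
- apply is_derive_cwave.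
- unfold dwave, cwave, Ci, RtoC, expi; destruct a, b.
  unfold Cmult, Cminus, Cplus, Copp; simpl; f_equal; ring.
Qed.

Lemma helmholtz_cwave k D a b : helmholtz k D (cwave k a b).
Proof.
exists (dwave k a b); intros x _; split;
  [apply is_derive_cwave | apply is_derive_dwave].
Qed.

Lemma derive_zero_constant (D : R -> Prop) (f : R -> R) :
  (forall x y z, D x -> D y -> x <= z <= y -> D z) ->
  (forall x, D x -> is_derive f x 0) ->
  forall x y, D x -> D y -> f x = f y.
Proof.
intros Hc Hf.
assert (H : forall x y, D x -> D y -> x < y -> f x = f y).
{ intros x y Hx Hy Hxy.
  apply (eq_is_derive (V := R_NormedModule)); [|exact Hxy].
  intros t Ht; apply Hf; now apply (Hc x y). }
intros x y Hx Hy; destruct (Rtotal_order x y) as [L|[E|L]].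
- now apply H.
- now subst.
- symmetry; now apply H.
Qed.

Lemma helmholtz_real k (D : R -> Prop) (f df : R -> R) (x0 : R) :
  k <> 0 -> (forall x y z, D x -> D y -> x <= z <= y -> D z) -> D x0 ->
  (forall x, D x -> is_derive f x (df x) /\ is_derive df x (- (k ^ 2 * f x))) ->
  exists P Q, forall x, D x -> f x = P * cos (k * x) + Q * sin (k * x).
Proof.
intros Hk Hc H0 H.
set (P := fun x => f x * cos (k * x) - df x * sin (k * x) / k).
set (Q := fun x => f x * sin (k * x) + df x * cos (k * x) / k).
assert (HP : forall x, D x -> is_derive P x 0).
{ intros x Hx; destruct (H x Hx) as [A B].
  unfold P; auto_derive.
  - split; [now exists (df x)|]. split; [|exact I]. now exists (- (k ^ 2 * f x)).
  - rewrite (is_derive_unique _ _ _ A : Derive (fun y => f y) x = _).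
    rewrite (is_derive_unique _ _ _ B : Derive (fun y => df y) x = _).
    field; exact Hk. }
assert (HQ : forall x, D x -> is_derive Q x 0).
{ intros x Hx; destruct (H x Hx) as [A B].
  unfold Q; auto_derive.
  - split; [now exists (df x)|]. split; [|exact I]. now exists (- (k ^ 2 * f x)).
  - rewrite (is_derive_unique _ _ _ A : Derive (fun y => f y) x = _).
    rewrite (is_derive_unique _ _ _ B : Derive (fun y => df y) x = _).
    field; exact Hk. }
exists (P x0), (Q x0); intros x Hx.
rewrite (derive_zero_constant D P Hc HP x0 x H0 Hx).
rewrite (derive_zero_constant D Q Hc HQ x0 x H0 Hx).
unfold P, Q.
assert (E := sin2_cos2 (k * x)); unfold Rsqr in E.
transitivity (f x * (sin (k * x) * sin (k * x) + cos (k * x) * cos (k * x))).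
- rewrite E; ring.
- field; exact Hk.
Qed.

Lemma helmholtz_general k (D : R -> Prop) (f : R -> C) (x0 : R) :
  k <> 0 -> (forall x y z, D x -> D y -> x <= z <= y -> D z) -> D x0 ->
  helmholtz k D f ->
  exists a b, forall x, D x -> f x = cwave k a b x.
Proof.
intros Hk Hc H0 [df H].
destruct (helmholtz_real k D (fun x => fst (f x)) (fun x => fst (df x)) x0 Hk Hc H0)
  as (P1 & Q1 & E1).
{ intros x Hx; destruct (H x Hx) as [A B].
  apply is_derive_C in A; apply is_derive_C in B; split; [apply A|].
  destruct B as [B _]; revert B; unfold RtoC, Cmult, Copp; simpl.
  now replace (- (k * (k * 1) * fst (f x) - 0 * snd (f x)))
    with (- (k * (k * 1) * fst (f x))) by ring. }
destruct (helmholtz_real k D (fun x => snd (f x)) (fun x => snd (df x)) x0 Hk Hc H0)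
  as (P2 & Q2 & E2).
{ intros x Hx; destruct (H x Hx) as [A B].
  apply is_derive_C in A; apply is_derive_C in B; split; [apply A|].
  destruct B as [_ B]; revert B; unfold RtoC, Cmult, Copp; simpl.
  now replace (- (k * (k * 1) * snd (f x) + 0 * fst (f x)))
    with (- (k * (k * 1) * snd (f x))) by ring. }
exists ((P1 + Q2) / 2, (P2 - Q1) / 2), ((P1 - Q2) / 2, (P2 + Q1) / 2).
intros x Hx; rewrite (surjective_pairing (f x)), (E1 x Hx), (E2 x Hx).
unfold cwave, expi, Cplus, Cmult; simpl.
rewrite cos_neg, sin_neg; f_equal; field.
Qed.

Lemma is_derive_C_comp (g : R -> C) (u : C) (phi : R -> R) (x d : R) :
  is_derive (V := C_R_NormedModule) g (phi x) u -> is_derive phi x d ->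
  is_derive (V := C_R_NormedModule) (fun y => g (phi y)) x (RtoC d * u)%C.
Proof.
intros Hg Hp.
apply is_derive_C in Hg; destruct Hg as [H1 H2].
apply is_derive_C; split.
- replace (fst (RtoC d * u)%C) with (scal d (fst u)).
  + exact (is_derive_comp (fun y => fst (g y)) phi x _ _ H1 Hp).
  + unfold RtoC, Cmult, scal; simpl; unfold mult; simpl; ring.
- replace (snd (RtoC d * u)%C) with (scal d (snd u)).
  + exact (is_derive_comp (fun y => snd (g y)) phi x _ _ H2 Hp).
  + unfold RtoC, Cmult, scal; simpl; unfold mult; simpl; ring.
Qed.

Lemma boundary_values_right (f g dg : R -> C) (x del : R) :
  (forall y, is_derive (V := C_R_NormedModule) g y (dg y)) ->
  0 < del -> (forall tau, 0 < tau < del -> f (x + tau) = g (x + tau)) ->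
  boundary_values (fun tau => f (x + tau)) (g x) (dg x).
Proof.
intros Hg Hd E.
apply (boundary_values_ext del (fun tau => g (x + tau))); [exact Hd|..].
{ intros tau Ht; symmetry; now apply E. }
assert (B := boundary_values_derive (fun tau => g (x + tau)) (RtoC 1 * dg x)%C).
simpl in B; rewrite Rplus_0_r, Cmult_1_l in B; apply B.
rewrite <- (Cmult_1_l (dg x)).
apply (is_derive_C_comp g (dg x) (fun tau => x + tau) 0 1).
- rewrite Rplus_0_r; apply Hg.
- auto_derive; [exact I|ring].
Qed.

Lemma Cmult_m1 (z : C) : (RtoC (-1) * z)%C = (- z)%C.
Proof. unfold Cmult, Copp, RtoC; simpl; f_equal; ring. Qed.

Lemma boundary_values_left (f g dg : R -> C) (x del : R) :
  (forall y, is_derive (V := C_R_NormedModule) g y (dg y)) ->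
  0 < del -> (forall tau, 0 < tau < del -> f (x - tau) = g (x - tau)) ->
  boundary_values (fun tau => f (x - tau)) (g x) (- dg x).
Proof.
intros Hg Hd E.
apply (boundary_values_ext del (fun tau => g (x - tau))); [exact Hd|..].
{ intros tau Ht; symmetry; now apply E. }
assert (B := boundary_values_derive (fun tau => g (x - tau)) (RtoC (-1) * dg x)%C).
simpl in B; rewrite Rminus_0_r in B.
rewrite Cmult_m1 in B.
apply B.
rewrite <- Cmult_m1.
apply (is_derive_C_comp g (dg x) (fun tau => x - tau) 0 (-1)).
- rewrite Rminus_0_r; apply Hg.
- auto_derive; [exact I|ring].
Qed.

(* Im (conj p * d), the probability current. *)
Definition flux (p d : C) : R := fst p * snd d - snd p * fst d.

Definition sqn (z : C) : R := fst z ^ 2 + snd z ^ 2.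

Lemma flux_cwave k a b x :
  flux (cwave k a b x) (dwave k a b x) = k * (sqn a - sqn b).
Proof.
destruct a as [a1 a2], b as [b1 b2].
unfold flux, sqn, cwave, dwave, expi, Cplus, Cminus, Copp, Cmult, Ci, RtoC; simpl.
rewrite cos_neg, sin_neg.
assert (E := sin2_cos2 (k * x)); unfold Rsqr in E.
set (c := cos (k * x)) in *; set (s := sin (k * x)) in *.
transitivity ((s * s + c * c) * (k * (a1 * a1 + a2 * a2 - (b1 * b1 + b2 * b2)))).
- ring.
- rewrite E; ring.
Qed.

Lemma flux_opp p d : flux p (- d) = - flux p d.
Proof. unfold flux, Copp; simpl; ring. Qed.

Lemma flux_opp_l p d : flux d p = - flux p d.
Proof. unfold flux; ring. Qed.

Lemma flux_vertex_aux th1 th2 th3 p1 p2 p3 d1 d2 d3 :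
  th1 <> 0 -> th2 <> 0 -> th3 <> 0 ->
  (p1 / RtoC th1 = p2 / RtoC th2)%C -> (p2 / RtoC th2 = p3 / RtoC th3)%C ->
  (RtoC th1 * d1 + RtoC th2 * d2 + RtoC th3 * d3 = 0)%C ->
  flux p1 d1 + flux p2 d2 + flux p3 d3 = 0.
Proof.
intros H1 H2 H3 E1 E2 E3.
assert (A : forall th (p : C), th <> 0 -> p = (RtoC th * (p / RtoC th))%C).
{ intros th p H; field; intro E; apply H; now apply RtoC_inj. }
rewrite (A _ p1 H1), (A _ p2 H2), (A _ p3 H3), <- E2, <- E1.
generalize (p1 / RtoC th1)%C; intros [z1 z2].
destruct d1 as [u1 v1], d2 as [u2 v2], d3 as [u3 v3].
unfold Cplus, Cmult, RtoC in E3; simpl in E3; injection E3; intros F1 F2.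
unfold flux, Cmult, RtoC; simpl.
transitivity (z1 * (th1 * v1 + th2 * v2 + th3 * v3)
              - z2 * (th1 * u1 + th2 * u2 + th3 * u3)); [ring|].
replace (th1 * v1 + th2 * v2 + th3 * v3) with 0 by lra.
replace (th1 * u1 + th2 * u2 + th3 * u3) with 0 by lra.
ring.
Qed.

Lemma flux_vertex ty th1 th2 th3 p1 p2 p3 d1 d2 d3 :
  th1 <> 0 -> th2 <> 0 -> th3 <> 0 ->
  vertex_condition ty th1 th2 th3 p1 p2 p3 d1 d2 d3 ->
  flux p1 d1 + flux p2 d2 + flux p3 d3 = 0.
Proof.
intros H1 H2 H3; destruct ty; intros (E1 & E2 & E3).
- now apply (flux_vertex_aux th1 th2 th3).
- assert (F := flux_vertex_aux th1 th2 th3 d1 d2 d3 p1 p2 p3 H1 H2 H3 E1 E2 E3).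
  rewrite (flux_opp_l p1), (flux_opp_l p2), (flux_opp_l p3) in F; lra.
Qed.

Lemma flux_endpoint alpha beta p d :
  (alpha, beta) <> (0, 0) ->
  (RtoC alpha * p + RtoC beta * d = 0)%C -> flux p d = 0.
Proof.
intros H E; destruct p as [p1 p2], d as [d1 d2].
unfold Cplus, Cmult, RtoC in E; simpl in E; injection E; intros F2 F1.
unfold flux; simpl.
destruct (Req_dec alpha 0) as [Ha|Ha].
- destruct (Req_dec beta 0) as [Hb|Hb]; [now subst|].
  apply (Rmult_eq_reg_l beta); [|exact Hb].
  subst alpha; transitivity (p1 * (beta * d2) - p2 * (beta * d1)); [ring|].
  replace (beta * d2) with 0 by lra; replace (beta * d1) with 0 by lra; ring.
- apply (Rmult_eq_reg_l alpha); [|exact Ha].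
  transitivity ((alpha * p1) * d2 - (alpha * p2) * d1); [ring|].
  replace (alpha * p1) with (- beta * d1) by lra.
  replace (alpha * p2) with (- beta * d2) by lra; ring.
Qed.

Lemma vertex_condition_minus ty th1 th2 th3 p1 p2 p3 d1 d2 d3 q1 q2 q3 e1 e2 e3 :
  vertex_condition ty th1 th2 th3 p1 p2 p3 d1 d2 d3 ->
  vertex_condition ty th1 th2 th3 q1 q2 q3 e1 e2 e3 ->
  vertex_condition ty th1 th2 th3 (p1 - q1) (p2 - q2) (p3 - q3)
    (d1 - e1) (d2 - e2) (d3 - e3).
Proof.
assert (M : forall u v w z x y : C, (u / x = v / y)%C -> (w / x = z / y)%C ->
  ((u - w) / x = (v - z) / y)%C).
{ intros u v w z x y A B; unfold Cdiv in *.
  replace ((u - w) * / x)%C with (u * / x - w * / x)%C by ring.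
  rewrite A, B; ring. }
destruct ty; intros (E1 & E2 & E3) (F1 & F2 & F3); (split; [|split]); auto.
- transitivity ((RtoC th1 * d1 + RtoC th2 * d2 + RtoC th3 * d3)
    - (RtoC th1 * e1 + RtoC th2 * e2 + RtoC th3 * e3))%C; [ring|].
  rewrite E3, F3; ring.
- transitivity ((RtoC th1 * p1 + RtoC th2 * p2 + RtoC th3 * p3)
    - (RtoC th1 * q1 + RtoC th2 * q2 + RtoC th3 * q3))%C; [ring|].
  rewrite E3, F3; ring.
Qed.

Lemma cwave_minus k a b a' b' x :
  (cwave k a b x - cwave k a' b' x)%C = cwave k (a - a') (b - b') x.
Proof. unfold cwave; ring. Qed.

Lemma dwave_minus k a b a' b' x :
  (dwave k a b x - dwave k a' b' x)%C = dwave k (a - a') (b - b') x.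
Proof. unfold dwave; ring. Qed.

Lemma vertex_pos_S h j : vertex_pos h (S j) = vertex_pos h j + h.
Proof. unfold vertex_pos; rewrite S_INR; ring. Qed.

Lemma channel_edge_convex N h j x y z :
  channel_edge N h j x -> channel_edge N h j y -> x <= z <= y ->
  channel_edge N h j z.
Proof.
intros [A1 A2] [B1 B2] [H1 H2]; split; intros H.
- specialize (A1 H); lra.
- specialize (B2 H); lra.
Qed.

Lemma channel_edge_mid N h j : 0 < h ->
  forall tau, 0 < tau < h -> channel_edge N h j (vertex_pos h j + tau).
Proof. intros Hh tau Ht; split; rewrite ?vertex_pos_S; lra. Qed.

Lemma channel_edge_left N h j : 0 < h ->
  forall tau, 0 < tau < h -> channel_edge N h j (vertex_pos h (S j) - tau).
Proof. intros Hh tau Ht; split; rewrite ?vertex_pos_S; lra. Qed.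

(* [channel psi] and [resonator psi] in terms of plane wave coefficients *)
Lemma scattering_coefficients ty N h l alpha beta th1 th2 th3 k psi r t :
  0 < h -> 0 < l -> k <> 0 ->
  scattering_solution ty N h l alpha beta th1 th2 th3 k psi r t ->
  (forall j, (j <= N)%nat -> exists a b, forall x, channel_edge N h j x ->
     channel psi j x = cwave k a b x) /\
  (forall j a0 b0 a b, (S j <= N)%nat ->
     (forall x, channel_edge N h j x -> channel psi j x = cwave k a0 b0 x) ->
     (forall x, channel_edge N h (S j) x -> channel psi (S j) x = cwave k a b x) ->
     exists A B, let x := vertex_pos h (S j) in
       vertex_condition ty th1 th2 th3
         (cwave k a0 b0 x) (cwave k a b x) (cwave k A B 0)
         (- dwave k a0 b0 x) (dwave k a b x) (dwave k A B 0) /\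
       (RtoC alpha * cwave k A B l + RtoC beta * dwave k A B l = 0)%C).
Proof.
intros Hh Hl Hk (H1 & H2 & H3 & H4 & _); split.
- intros j Hj.
  apply (helmholtz_general k _ _ (vertex_pos h j + h / 2)); auto.
  + apply channel_edge_convex.
  + apply channel_edge_mid; lra.
- intros j a0 b0 a b Hj E0 E.
  destruct (helmholtz_general k (fun s => 0 < s < l) (resonator psi (S j)) (l / 2))
    as (A & B & ER); auto; [intros; lra|lra|apply H2; lia|].
  exists A, B; intros x.
  destruct (H3 (S j) ltac:(lia)) as (p1 & p2 & p3 & d1 & d2 & d3 & B1 & B2 & B3 & V).
  simpl pred in B1.
  destruct (boundary_values_unique _ _ _ _ _ B1
    (boundary_values_left _ (cwave k a0 b0) (dwave k a0 b0) x h
       (is_derive_cwave k a0 b0) Hh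
       (fun tau Ht => E0 _ (channel_edge_left N h j Hh tau Ht)))) as [-> ->].
  destruct (boundary_values_unique _ _ _ _ _ B2
    (boundary_values_right _ (cwave k a b) (dwave k a b) x h
       (is_derive_cwave k a b) Hh
       (fun tau Ht => E _ (channel_edge_mid N h (S j) Hh tau Ht)))) as [-> ->].
  assert (B3' : boundary_values (fun tau => resonator psi (S j) (0 + tau)) p3 d3).
  { revert B3; apply (boundary_values_ext 1); [lra|].
    intros; now rewrite Rplus_0_l. }
  destruct (boundary_values_unique _ _ _ _ _ B3'
    (boundary_values_right _ (cwave k A B) (dwave k A B) 0 l
       (is_derive_cwave k A B) Hl
       (fun tau Ht => ER (0 + tau) ltac:(lra)))) as [-> ->].
  destruct (H4 (S j) ltac:(lia)) as (p & d & B4 & V4).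
  destruct (boundary_values_unique _ _ _ _ _ B4
    (boundary_values_left _ (cwave k A B) (dwave k A B) l l
       (is_derive_cwave k A B) Hl
       (fun tau Ht => ER (l - tau) ltac:(lra)))) as [-> ->].
  split; [exact V|]. rewrite <- V4; ring.
Qed.

Lemma cwave_eq_on_edge N h j k a b a' b' : 0 < h -> k <> 0 ->
  (forall x, channel_edge N h j x -> cwave k a b x = cwave k a' b' x) ->
  a = a' /\ b = b'.
Proof.
intros Hh Hk E.
set (x := vertex_pos h j).
destruct (boundary_values_unique _ _ _ _ _
  (boundary_values_right (cwave k a b) (cwave k a b) (dwave k a b) x h
    (is_derive_cwave k a b) Hh (fun _ _ => eq_refl))
  (boundary_values_right (cwave k a b) (cwave k a' b') (dwave k a' b') x h
    (is_derive_cwave k a' b') Hh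
    (fun tau Ht => E _ (channel_edge_mid N h j Hh tau Ht)))) as [P D].
unfold cwave in P; unfold dwave in D.
assert (Hik : (Ci * RtoC k)%C <> RtoC 0).
{ intros F; injection F; intros; apply Hk; lra. }
assert (X : (expi (- (k * x)) * expi (k * x))%C = RtoC 1).
{ unfold expi, Cmult, RtoC; simpl; rewrite cos_neg, sin_neg.
  assert (S := sin2_cos2 (k * x)); unfold Rsqr in S; f_equal; nra. }
assert (D' : (a * expi (k * x) - b * expi (- (k * x))
  = a' * expi (k * x) - b' * expi (- (k * x)))%C).
{ assert (M : forall u v, (Ci * RtoC k * u = Ci * RtoC k * v)%C -> u = v).
  { intros u v F. replace u with ((Ci * RtoC k * u) / (Ci * RtoC k))%C by
      (field; split; [intros G; apply Hk; now apply RtoC_inj|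
        intros G; injection G; lra]).
    rewrite F; field; split; [intros G; apply Hk; now apply RtoC_inj|
        intros G; injection G; lra]. }
  now apply M. }
assert (H2 : (RtoC 2 <> 0)%C) by (intros G; apply RtoC_inj in G; lra).
set (e := expi (k * x)) in *; set (f := expi (- (k * x))) in *.
assert (I : forall a b : C, a = (((a * e + b * f) + (a * e - b * f)) / RtoC 2 * f)%C).
{ intros u v. transitivity (u * (f * e))%C; [rewrite X; ring | field; exact H2]. }
assert (J : forall a b : C, b = (((a * e + b * f) - (a * e - b * f)) / RtoC 2 * e)%C).
{ intros u v. transitivity (v * (f * e))%C; [rewrite X; ring | field; exact H2]. }
split.
- rewrite (I a b), (I a' b'), P, D'; reflexivity.
- rewrite (J a b), (J a' b'), P, D'; reflexivity.
Qed.

Lemma sqn_pos z : 0 <= sqn z.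
Proof. unfold sqn; nra. Qed.

Lemma sqn_0 z : sqn z = 0 -> z = RtoC 0.
Proof.
unfold sqn; destruct z as [x y]; simpl; intros H; unfold RtoC; f_equal; nra.
Qed.

Lemma transmission_amplitude_unique ty N h l alpha beta th1 th2 th3 k t t' :
  0 < h -> 0 < l -> (alpha, beta) <> (0, 0) -> th1 * th2 * th3 <> 0 ->
  0 < k ->
  is_transmission_amplitude ty N h l alpha beta th1 th2 th3 k t ->
  is_transmission_amplitude ty N h l alpha beta th1 th2 th3 k t' ->
  t = t'.
Proof.
intros Hh Hl Hab Hth Hk (psi & r & S) (psi' & r' & S').
assert (Hk0 : k <> 0) by lra.
assert (T1 : th1 <> 0) by (intros E; apply Hth; rewrite E; ring).
assert (T2 : th2 <> 0) by (intros E; apply Hth; rewrite E; ring).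
assert (T3 : th3 <> 0) by (intros E; apply Hth; rewrite E; ring).
destruct (scattering_coefficients _ _ _ _ _ _ _ _ _ _ _ _ _ Hh Hl Hk0 S) as [C1 C2].
destruct (scattering_coefficients _ _ _ _ _ _ _ _ _ _ _ _ _ Hh Hl Hk0 S') as [C1' C2'].
destruct S as (_ & _ & _ & _ & L & M), S' as (_ & _ & _ & _ & L' & M').
assert (Ind : forall j, (j <= N)%nat -> forall a b a' b',
  (forall x, channel_edge N h j x -> channel psi j x = cwave k a b x) ->
  (forall x, channel_edge N h j x -> channel psi' j x = cwave k a' b' x) ->
  sqn (a - a') - sqn (b - b') = - sqn (r - r')).
{ induction j as [|j IH]; intros Hj a b a' b' E E'.
  - destruct (cwave_eq_on_edge N h 0 k a b (RtoC 1) r Hh Hk0) as [-> ->].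
    { intros x Hx; rewrite <- E, L by assumption; unfold cwave; ring. }
    destruct (cwave_eq_on_edge N h 0 k a' b' (RtoC 1) r' Hh Hk0) as [-> ->].
    { intros x Hx; rewrite <- E', L' by assumption; unfold cwave; ring. }
    unfold sqn, Cminus, Cplus, Copp, RtoC; simpl; ring.
  - destruct (C1 j ltac:(lia)) as (a0 & b0 & E0).
    destruct (C1' j ltac:(lia)) as (a0' & b0' & E0').
    rewrite <- (IH ltac:(lia) a0 b0 a0' b0' E0 E0').
    destruct (C2 j a0 b0 a b Hj E0 E) as (A & B & V & W).
    destruct (C2' j a0' b0' a' b' Hj E0' E') as (A' & B' & V' & W').
    set (x := vertex_pos h (S j)) in *.
    assert (F := vertex_condition_minus _ _ _ _ _ _ _ _ _ _ _ _ _ _ _ _ V V').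
    apply (flux_vertex _ _ _ _ _ _ _ _ _ _ T1 T2 T3) in F.
    replace (- dwave k a0 b0 x - - dwave k a0' b0' x)%C
      with (- (dwave k a0 b0 x - dwave k a0' b0' x))%C in F by ring.
    rewrite !cwave_minus, !dwave_minus, flux_opp, !flux_cwave in F.
    assert (G : (RtoC alpha * cwave k (A - A') (B - B') l
                 + RtoC beta * dwave k (A - A') (B - B') l = 0)%C).
    { rewrite <- cwave_minus, <- dwave_minus.
      transitivity ((RtoC alpha * cwave k A B l + RtoC beta * dwave k A B l)
        - (RtoC alpha * cwave k A' B' l + RtoC beta * dwave k A' B' l))%C; [ring|].
      rewrite W, W'; ring. }
    apply (flux_endpoint _ _ _ _ Hab) in G; rewrite flux_cwave in G.
    apply (Rmult_eq_reg_l k); [|exact Hk0]. lra. }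
specialize (Ind N (le_n N) t (RtoC 0) t' (RtoC 0)).
assert (Q : sqn (t - t') - sqn (RtoC 0 - RtoC 0) = - sqn (r - r')).
{ apply Ind; intros x Hx; [rewrite M by assumption|rewrite M' by assumption];
    unfold cwave; ring. }
assert (Z : sqn (RtoC 0 - RtoC 0) = 0)
  by (unfold sqn, Cminus, Cplus, Copp, RtoC; simpl; ring).
assert (P1 := sqn_pos (t - t')%C); assert (P2 := sqn_pos (r - r')%C).
assert (K : sqn (t - t') = 0) by lra.
apply sqn_0 in K.
replace t with ((t - t') + t')%C by ring; rewrite K; ring.
Qed.

(* A solution on the resonator satisfying the endpoint condition. *)
Definition rwave (k l alpha beta s : R) : R :=
  beta * cos (k * (l - s)) + alpha / k * sin (k * (l - s)).

Definition drwave (k l alpha beta s : R) : R :=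
  k * beta * sin (k * (l - s)) - alpha * cos (k * (l - s)).

Lemma is_derive_rwave k l alpha beta c s : k <> 0 ->
  is_derive (V := C_R_NormedModule) (fun s => (c * RtoC (rwave k l alpha beta s))%C) s
    (c * RtoC (drwave k l alpha beta s))%C.
Proof.
intros Hk; apply is_derive_C; destruct c as [c1 c2].
unfold Cmult, RtoC, rwave, drwave, Rminus; simpl; split; auto_derive;
  try exact I; field; exact Hk.
Qed.

Lemma is_derive_drwave k l alpha beta c s : k <> 0 ->
  is_derive (V := C_R_NormedModule) (fun s => (c * RtoC (drwave k l alpha beta s))%C) s
    (- (RtoC (k ^ 2) * (c * RtoC (rwave k l alpha beta s))))%C.
Proof.
intros Hk; apply is_derive_C; destruct c as [c1 c2].
unfold Cmult, Copp, RtoC, rwave, drwave, Rminus; simpl; split; auto_derive;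
  try exact I; field; exact Hk.
Qed.

Lemma rwave_nontrivial k l alpha beta : k <> 0 -> (alpha, beta) <> (0, 0) ->
  rwave k l alpha beta 0 = 0 -> drwave k l alpha beta 0 = 0 -> False.
Proof.
unfold rwave, drwave; intros Hk H A B; rewrite Rminus_0_r in *.
set (c := cos (k * l)) in *; set (s := sin (k * l)) in *.
assert (E := sin2_cos2 (k * l)); unfold Rsqr in E; fold c s in E.
assert (A' : k * beta * c + alpha * s = 0).
{ replace (k * beta * c + alpha * s) with (k * (beta * c + alpha / k * s))
    by (field; exact Hk). rewrite A; ring. }
assert (Ea : alpha = 0).
{ transitivity (alpha * (s * s + c * c)); [rewrite E; ring|].
  transitivity (s * (k * beta * c + alpha * s) - c * (k * beta * s - alpha * c));
    [ring|]. rewrite A', B; ring. }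
assert (Eb : k * beta = 0).
{ transitivity (k * beta * (s * s + c * c)); [rewrite E; ring|].
  transitivity (c * (k * beta * c + alpha * s) + s * (k * beta * s - alpha * c));
    [ring|]. rewrite A', B; ring. }
apply Rmult_integral in Eb; destruct Eb as [Eb|Eb]; [now apply Hk|].
apply H; now rewrite Ea, Eb.
Qed.

(* Coefficients satisfying the vertex conditions give a scattering solution. *)
Lemma scattering_of_coefficients ty N h l alpha beta th1 th2 th3 k
    (a b c : nat -> C) :
  0 < h -> 0 < l -> k <> 0 ->
  (forall j, (1 <= j <= N)%nat -> let x := vertex_pos h j in
     vertex_condition ty th1 th2 th3
       (cwave k (a (pred j)) (b (pred j)) x) (cwave k (a j) (b j) x)
       (c j * RtoC (rwave k l alpha beta 0))
       (- dwave k (a (pred j)) (b (pred j)) x) (dwave k (a j) (b j) x)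
       (c j * RtoC (drwave k l alpha beta 0))) ->
  a 0%nat = RtoC 1 -> b N = RtoC 0 ->
  is_transmission_amplitude ty N h l alpha beta th1 th2 th3 k (a N).
Proof.
intros Hh Hl Hk V A0 BN.
exists (GraphFunction (fun j => cwave k (a j) (b j))
  (fun j s => (c j * RtoC (rwave k l alpha beta s))%C)), (b 0%nat).
split; [|split; [|split; [|split; [|split]]]]; simpl.
- intros j _; apply helmholtz_cwave.
- intros j _; exists (fun s => (c j * RtoC (drwave k l alpha beta s))%C).
  intros s _; split; [now apply is_derive_rwave | now apply is_derive_drwave].
- intros j Hj; do 6 eexists; split; [|split; [|split; [|apply (V j Hj)]]].
  + apply (boundary_values_left _ _ _ _ 1 (is_derive_cwave k _ _)); [lra|reflexivity].
  + apply (boundary_values_right _ _ _ _ 1 (is_derive_cwave k _ _)); [lra|reflexivity].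
  + apply (boundary_values_derive
      (fun tau => (c j * RtoC (rwave k l alpha beta tau))%C)).
    now apply is_derive_rwave.
- intros j Hj.
  exists (c j * RtoC (rwave k l alpha beta l))%C,
    (- (c j * RtoC (drwave k l alpha beta l)))%C; split.
  + apply (boundary_values_left
      (fun s => (c j * RtoC (rwave k l alpha beta s))%C)
      (fun s => (c j * RtoC (rwave k l alpha beta s))%C)
      (fun s => (c j * RtoC (drwave k l alpha beta s))%C) l 1); [|lra|reflexivity].
    intros y; now apply is_derive_rwave.
  + transitivity (c j * RtoC (alpha * rwave k l alpha beta l
      + beta * drwave k l alpha beta l))%C.
    { rewrite RtoC_plus, !RtoC_mult; ring. }
    unfold rwave, drwave; rewrite Rminus_diag, Rmult_0_r, cos_0, sin_0.
    replace (alpha * (beta * 1 + alpha / k * 0) + beta * (k * beta * 0 - alpha * 1))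
      with 0 by ring. ring.
- intros x _; unfold cwave; rewrite A0; ring.
- intros x _; unfold cwave; rewrite BN; ring.
Qed.

Lemma cwave_interpolate k x p q : k <> 0 ->
  exists a b, cwave k a b x = p /\ dwave k a b x = q.
Proof.
intros Hk.
set (e := expi (k * x)); set (f := expi (- (k * x))).
assert (X : (f * e)%C = RtoC 1).
{ unfold e, f, expi, Cmult, RtoC; simpl; rewrite cos_neg, sin_neg.
  assert (S := sin2_cos2 (k * x)); unfold Rsqr in S; f_equal; nra. }
assert (H2 : (RtoC 2 <> 0)%C) by (intros G; apply RtoC_inj in G; lra).
assert (Hk' : (RtoC k <> 0)%C) by (intros G; apply Hk; now apply RtoC_inj).
assert (Hi : (Ci <> 0)%C) by (intros G; injection G; lra).
exists ((p + q / (Ci * RtoC k)) / RtoC 2 * f)%C,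
  ((p - q / (Ci * RtoC k)) / RtoC 2 * e)%C.
unfold cwave, dwave; fold e f; split.
- transitivity (p * (f * e))%C; [field; auto | rewrite X; ring].
- transitivity (q * (f * e))%C; [field; auto | rewrite X; ring].
Qed.

Lemma vertex_solve ty k l alpha beta th1 th2 th3 x (a b : C) :
  k <> 0 -> th1 <> 0 -> th2 <> 0 -> th3 <> 0 ->
  match ty with
  | TypeI => rwave k l alpha beta 0 <> 0
  | TypeII => drwave k l alpha beta 0 <> 0
  end ->
  exists a0 b0 c,
    vertex_condition ty th1 th2 th3
      (cwave k a0 b0 x) (cwave k a b x) (c * RtoC (rwave k l alpha beta 0))
      (- dwave k a0 b0 x) (dwave k a b x) (c * RtoC (drwave k l alpha beta 0)) /\
    sqn a0 - sqn b0 = sqn a - sqn b.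
Proof.
intros Hk T1 T2 T3 H.
set (f0 := rwave k l alpha beta 0) in *; set (f1 := drwave k l alpha beta 0) in *.
assert (R0 : forall z : R, z <> 0 -> (RtoC z <> 0)%C).
{ intros z Hz G; apply Hz; now apply RtoC_inj. }
assert (S : exists a0 b0 c, vertex_condition ty th1 th2 th3
      (cwave k a0 b0 x) (cwave k a b x) (c * RtoC f0)
      (- dwave k a0 b0 x) (dwave k a b x) (c * RtoC f1)).
{ destruct ty.
  - set (p := cwave k a b x); set (q := dwave k a b x).
    set (c := (RtoC th3 / RtoC th2 * p / RtoC f0)%C).
    destruct (cwave_interpolate k x (RtoC th1 / RtoC th2 * p)
      ((RtoC th2 * q + RtoC th3 * (c * RtoC f1)) / RtoC th1) Hk) as (a0 & b0 & E1 & E2).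
    exists a0, b0, c; simpl; rewrite E1, E2; unfold c; repeat split; field; auto.
  - set (p := cwave k a b x); set (q := dwave k a b x).
    set (c := (RtoC th3 / RtoC th2 * q / RtoC f1)%C).
    destruct (cwave_interpolate k x
      (- ((RtoC th2 * p + RtoC th3 * (c * RtoC f0)) / RtoC th1))
      (- (RtoC th1 / RtoC th2 * q)) Hk) as (a0 & b0 & E1 & E2).
    exists a0, b0, c; simpl; rewrite E1, E2; unfold c; repeat split; field; auto. }
destruct S as (a0 & b0 & c & V); exists a0, b0, c; split; [exact V|].
apply (flux_vertex _ _ _ _ _ _ _ _ _ _ T1 T2 T3) in V.
rewrite flux_opp, !flux_cwave in V.
assert (Z : flux (c * RtoC f0) (c * RtoC f1) = 0)
  by (unfold flux, Cmult, RtoC; simpl; ring).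
apply (Rmult_eq_reg_l k); [lra|exact Hk].
Qed.

Lemma backward_sequence (S : Type) (P : nat -> S -> S -> Prop) :
  (forall j s, exists s', P j s' s) ->
  forall N s, exists u : nat -> S,
    u N = s /\ forall j, (1 <= j <= N)%nat -> P j (u (pred j)) (u j).
Proof.
intros H; induction N as [|N IH]; intros s.
- exists (fun _ => s); split; [reflexivity|intros; lia].
- destruct (H (Datatypes.S N) s) as [s' Hs'].
  destruct (IH s') as (u & U1 & U2).
  exists (fun j => if Nat.eqb j (Datatypes.S N) then s else u j); split.
  { now rewrite Nat.eqb_refl. }
  intros j Hj.
  replace (Nat.eqb (pred j) (Datatypes.S N)) with false
    by (symmetry; apply Nat.eqb_neq; lia).
  destruct (Nat.eqb_spec j (Datatypes.S N)) as [->|D].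
  + simpl; now rewrite U1.
  + apply U2; lia.
Qed.

Lemma vertex_condition_scale ty th1 th2 th3 p1 p2 p3 d1 d2 d3 z :
  vertex_condition ty th1 th2 th3 p1 p2 p3 d1 d2 d3 ->
  vertex_condition ty th1 th2 th3 (z * p1) (z * p2) (z * p3)
    (z * d1) (z * d2) (z * d3).
Proof.
assert (M : forall u v x y : C, (u / x = v / y)%C -> (z * u / x = z * v / y)%C).
{ intros u v x y E; unfold Cdiv in *; rewrite <- !Cmult_assoc, E; reflexivity. }
destruct ty; intros (E1 & E2 & E3); (split; [|split]); auto.
- transitivity (z * (RtoC th1 * d1 + RtoC th2 * d2 + RtoC th3 * d3))%C; [ring|].
  rewrite E3; ring.
- transitivity (z * (RtoC th1 * p1 + RtoC th2 * p2 + RtoC th3 * p3))%C; [ring|].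
  rewrite E3; ring.
Qed.

Lemma transmission_amplitude_exists ty N h l alpha beta th1 th2 th3 k :
  (1 <= N)%nat -> 0 < h -> 0 < l -> (alpha, beta) <> (0, 0) ->
  th1 * th2 * th3 <> 0 -> 0 < k ->
  exists t, is_transmission_amplitude ty N h l alpha beta th1 th2 th3 k t.
Proof.
intros HN Hh Hl Hab Hth Hk.
assert (Hk0 : k <> 0) by lra.
assert (T1 : th1 <> 0) by (intros E; apply Hth; rewrite E; ring).
assert (T2 : th2 <> 0) by (intros E; apply Hth; rewrite E; ring).
assert (T3 : th3 <> 0) by (intros E; apply Hth; rewrite E; ring).
assert (R0 : forall z : R, z <> 0 -> (RtoC z <> 0)%C).
{ intros z Hz G; apply Hz; now apply RtoC_inj. }
set (f0 := rwave k l alpha beta 0); set (f1 := drwave k l alpha beta 0).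
assert (NT : f0 = 0 -> f1 = 0 -> False)
  by exact (rwave_nontrivial k l alpha beta Hk0 Hab).
assert (D : match ty with TypeI => f0 <> 0 | TypeII => f1 <> 0 end \/
            match ty with TypeI => f0 = 0 | TypeII => f1 = 0 end).
{ destruct ty; [destruct (Req_dec f0 0)|destruct (Req_dec f1 0)]; auto. }
destruct D as [D|D].
- destruct (backward_sequence (C * C * C)
    (fun j s' s => vertex_condition ty th1 th2 th3
       (cwave k (fst (fst s')) (snd (fst s')) (vertex_pos h j))
       (cwave k (fst (fst s)) (snd (fst s)) (vertex_pos h j))
       (snd s' * RtoC f0)
       (- dwave k (fst (fst s')) (snd (fst s')) (vertex_pos h j))
       (dwave k (fst (fst s)) (snd (fst s)) (vertex_pos h j))
       (snd s' * RtoC f1) /\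
       sqn (fst (fst s')) - sqn (snd (fst s'))
       = sqn (fst (fst s)) - sqn (snd (fst s)))) with (N := N)
    (s := (RtoC 1, RtoC 0, RtoC 0)) as (u & U1 & U2).
  { intros j [[a b] c0].
    destruct (vertex_solve ty k l alpha beta th1 th2 th3 (vertex_pos h j) a b
      Hk0 T1 T2 T3 D) as (a0 & b0 & c & V & F).
    exists (a0, b0, c); split; [exact V|exact F]. }
  assert (I : forall m, (m <= N)%nat ->
    sqn (fst (fst (u (N - m)%nat))) - sqn (snd (fst (u (N - m)%nat))) = 1).
  { induction m as [|m IH]; intros Hm.
    - rewrite Nat.sub_0_r, U1; unfold sqn, RtoC; simpl; ring.
    - rewrite <- (IH ltac:(lia)).
      destruct (U2 (N - m)%nat ltac:(lia)) as [_ E].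
      now replace (pred (N - m)) with (N - S m)%nat in E by lia. }
  specialize (I N (le_n N)); rewrite Nat.sub_diag in I.
  set (A := fst (fst (u 0%nat))) in *.
  assert (HA : A <> RtoC 0).
  { intros E; rewrite E in I; assert (Q := sqn_pos (snd (fst (u 0%nat)))).
    unfold sqn at 1 in I; unfold RtoC in I; simpl in I; lra. }
  exists (/ A * fst (fst (u N)))%C.
  apply (scattering_of_coefficients ty N h l alpha beta th1 th2 th3 k
    (fun j => / A * fst (fst (u j)))%C (fun j => / A * snd (fst (u j)))%C
    (fun j => / A * snd (u (pred j)))%C Hh Hl Hk0).
  + intros j Hj x.
    destruct (U2 j Hj) as [V _].
    apply (vertex_condition_scale _ _ _ _ _ _ _ _ _ _ (/ A)%C) in V.
    assert (SC : forall a b y, (/ A * cwave k a b y)%C = cwave k (/ A * a) (/ A * b) y)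
      by (intros; unfold cwave; ring).
    assert (SD : forall a b y, (/ A * dwave k a b y)%C = dwave k (/ A * a) (/ A * b) y)
      by (intros; unfold dwave; ring).
    assert (SO : forall w, (/ A * - w)%C = (- (/ A * w))%C) by (intros; ring).
    rewrite SO, !SC, !SD, !Cmult_assoc in V; exact V.
  + apply Cinv_l; exact HA.
  + rewrite U1; simpl; ring.
- set (s := match ty with TypeI => -1 | TypeII => 1 end).
  set (c := match ty with
            | TypeI => (RtoC 2 * Ci * RtoC k * RtoC th1 / (RtoC th3 * RtoC f1))%C
            | TypeII => (- (RtoC 2 * RtoC th1 / (RtoC th3 * RtoC f0)))%C end).
  exists (RtoC 0).
  assert (X0 : vertex_pos h 1 = 0) by (unfold vertex_pos; simpl; ring).
  replace (RtoC 0) with (if Nat.eqb N 0 then RtoC 1 else RtoC 0)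
    by (destruct N; [lia|reflexivity]).
  apply (scattering_of_coefficients ty N h l alpha beta th1 th2 th3 k
    (fun j => if Nat.eqb j 0 then RtoC 1 else RtoC 0)
    (fun j => if Nat.eqb j 0 then RtoC s else RtoC 0)
    (fun j => if Nat.eqb j 1 then c else RtoC 0) Hh Hl Hk0);
    [|reflexivity|destruct N; [lia|reflexivity]].
  fold f0 f1.
  intros j Hj x.
  assert (W0 : forall y, cwave k (RtoC 0) (RtoC 0) y = RtoC 0)
    by (intros; unfold cwave; ring).
  assert (D0 : forall y, dwave k (RtoC 0) (RtoC 0) y = RtoC 0)
    by (intros; unfold dwave; ring).
  destruct j as [|[|j]]; [lia| |].
  + simpl; unfold x; rewrite X0, W0, D0.
    unfold cwave, dwave.
    replace (expi (k * 0)) with (RtoC 1)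
      by (unfold expi; rewrite Rmult_0_r, cos_0, sin_0; reflexivity).
    replace (expi (- (k * 0))) with (RtoC 1)
      by (unfold expi; rewrite Rmult_0_r, Ropp_0, cos_0, sin_0; reflexivity).
    destruct ty; simpl in D; unfold vertex_condition, c, s; rewrite D, ?RtoC_opp.
    * assert (f1 <> 0) by (intros E; now apply NT). repeat split; field; auto.
    * assert (f0 <> 0) by (intros E; now apply NT). repeat split; field; auto.
  + simpl; rewrite W0, D0.
    destruct ty; simpl; repeat split; try field; auto.
Qed.

Theorem transmission_amplitude_unique_existence ty N h l alpha beta th1 th2 th3 k :
  (1 <= N)%nat -> 0 < h -> 0 < l -> (alpha, beta) <> (0, 0) ->
  th1 * th2 * th3 <> 0 -> 0 < k ->
  exists! t, is_transmission_amplitude ty N h l alpha beta th1 th2 th3 k t.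
Proof.
intros HN Hh Hl Hab Hth Hk.
destruct (transmission_amplitude_exists ty N h l alpha beta th1 th2 th3 k)
  as [t Ht]; auto.
exists t; split; [exact Ht|].
intros t' Ht'.
now apply (transmission_amplitude_unique ty N h l alpha beta th1 th2 th3 k).
Qed.

Corollary transmission_amplitude_spec ty N h l alpha beta th1 th2 th3 k :
  (1 <= N)%nat -> 0 < h -> 0 < l -> (alpha, beta) <> (0, 0) ->
  th1 * th2 * th3 <> 0 -> 0 < k ->
  is_transmission_amplitude ty N h l alpha beta th1 th2 th3 k
    (transmission_amplitude ty N h l alpha beta th1 th2 th3 k).
Proof.
intros HN Hh Hl Hab Hth Hk.
exact (iota_correct (V := C_CompleteNormedModule) _
  (transmission_amplitude_unique_existence ty N h l alpha beta th1 th2 th3 k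
     HN Hh Hl Hab Hth Hk)).
Qed.

(* Main.v *)
Require Import Defs.
From Stdlib Require Import Reals.
From Coquelicot Require Import Coquelicot.
From Stdlib Require Import Lra Lia.
Open Scope R_scope.

(** The signs of the [theta]'s can be absorbed by a gauge transformation.  If
    [psi] solves the scattering problem for [(th1, th2, th3)], multiply it by
    the sign [(e1 * e2) ^ j] on the [j]-th channel edge and by
    [e1 * e3 * (e1 * e2) ^ (j - 1)] on the resonator at [v_j].  Each edge gets
    one constant factor, so the Helmholtz equation and the endpoint conditions
    survive; and at [v_j] the three factors are [e1], [e2], [e3] up to the
    common sign [e1 * (e1 * e2) ^ (j - 1)], which is exactly what turns the
    vertex condition for [(th1, th2, th3)] into the one for
    [(e1 * th1, e2 * th2, e3 * th3)].  The incoming lead has factor 1, so the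
    incident wave is unchanged, and the transmission amplitude gets the sign
    [(e1 * e2) ^ N], which its modulus does not see.  Uniqueness of the
    amplitude identifies the transformed amplitude with the one of the new
    system. *)

Lemma is_derive_Cscale (c : R) (f : R -> C) (x : R) (u : C) :
  is_derive (V := C_R_NormedModule) f x u ->
  is_derive (V := C_R_NormedModule) (fun y => (RtoC c * f y)%C) x (RtoC c * u)%C.
Proof.
intros H; apply is_derive_C in H; destruct H as [H1 H2].
assert (E1 : forall z : C, fst (RtoC c * z)%C = c * fst z)
  by (intros [a b]; simpl; ring).
assert (E2 : forall z : C, snd (RtoC c * z)%C = c * snd z)
  by (intros [a b]; simpl; ring).
apply is_derive_C; split.
- rewrite E1.
  apply (is_derive_ext (fun y => c * fst (f y))); [intros y; now rewrite E1|].
  now apply is_derive_scal.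
- rewrite E2.
  apply (is_derive_ext (fun y => c * snd (f y))); [intros y; now rewrite E2|].
  now apply is_derive_scal.
Qed.

Lemma helmholtz_scale (c k : R) (D : R -> Prop) (f : R -> C) :
  helmholtz k D f -> helmholtz k D (fun x => (RtoC c * f x)%C).
Proof.
intros [df H]; exists (fun x => (RtoC c * df x)%C); intros x Hx.
destruct (H x Hx) as [H1 H2]; split; [now apply is_derive_Cscale|].
replace (- (RtoC (k ^ 2) * (RtoC c * f x)))%C
  with (RtoC c * - (RtoC (k ^ 2) * f x))%C by ring.
now apply is_derive_Cscale.
Qed.

Lemma filterlim_Cscale (F : (R -> Prop) -> Prop) {FF : Filter F} (c : R)
    (f : R -> C) (u : C) :
  filterlim f F (locally u) ->
  filterlim (fun x => (RtoC c * f x)%C) F (locally (RtoC c * u)%C).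
Proof.
assert (E : forall z : C_R_NormedModule, scal c z = (RtoC c * z)%C).
{ intros [a b]; unfold Cmult, RtoC; simpl; apply injective_projections; simpl;
  unfold scal; simpl; unfold mult; simpl; ring. }
intros H; rewrite <- E.
apply (filterlim_ext (fun x => scal c (f x : C_R_NormedModule)));
  [intros x; apply E|].
exact (filterlim_comp _ _ _ _ _ _ _ _ H (filterlim_scal_r (V := C_R_NormedModule) c u)).
Qed.

Lemma boundary_values_scale (c : R) (g : R -> C) (p d : C) :
  boundary_values g p d ->
  boundary_values (fun tau => (RtoC c * g tau)%C) (RtoC c * p) (RtoC c * d).
Proof.
intros [H1 H2]; split; [now apply filterlim_Cscale; [typeclasses eauto|]|].
apply (filterlim_ext (fun tau : R => RtoC c * ((g tau - p) / RtoC tau))%C).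
- intros tau; unfold Cdiv; ring.
- now apply filterlim_Cscale; [typeclasses eauto|].
Qed.

Lemma sign_square (e : R) : e = 1 \/ e = -1 -> e * e = 1.
Proof. intros [-> | ->]; ring. Qed.

Lemma Cdiv_sign (e a : R) (p : C) : e = 1 \/ e = -1 -> a <> 0 ->
  (RtoC e * p / RtoC (e * a) = p / RtoC a)%C.
Proof.
intros He Ha.
assert (Ha' : RtoC a <> 0%C) by (intros G; apply Ha; now apply RtoC_inj).
assert (He' : RtoC e <> 0%C)
  by (intros G; apply RtoC_inj in G; destruct He; lra).
rewrite RtoC_mult; field; auto.
Qed.

(** Both types only involve the ratios of the paired quantities to the
    [theta]'s and their products with them; a sign flips both in the same way
    because it is its own inverse. *)
Lemma vertex_condition_signs (ty : vertex_type) (th1 th2 th3 e1 e2 e3 : R)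
    (p1 p2 p3 d1 d2 d3 : C) :
  th1 <> 0 -> th2 <> 0 -> th3 <> 0 ->
  e1 = 1 \/ e1 = -1 -> e2 = 1 \/ e2 = -1 -> e3 = 1 \/ e3 = -1 ->
  vertex_condition ty th1 th2 th3 p1 p2 p3 d1 d2 d3 ->
  vertex_condition ty (e1 * th1) (e2 * th2) (e3 * th3)
    (RtoC e1 * p1) (RtoC e2 * p2) (RtoC e3 * p3)
    (RtoC e1 * d1) (RtoC e2 * d2) (RtoC e3 * d3).
Proof.
intros T1 T2 T3 S1 S2 S3.
assert (M : forall (e a : R) (z : C), e = 1 \/ e = -1 ->
  (RtoC (e * a) * (RtoC e * z) = RtoC a * z)%C).
{ intros e a z He.
  transitivity (RtoC (e * e) * (RtoC a * z))%C; [rewrite !RtoC_mult; ring|].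
  rewrite sign_square by exact He; ring. }
destruct ty; simpl; intros V; rewrite !Cdiv_sign, !M; auto.
Qed.

Definition gauge (e1 e2 e3 : R) (psi : graph_function) : graph_function :=
  GraphFunction
    (fun j x => (RtoC ((e1 * e2) ^ j) * channel psi j x)%C)
    (fun j s => (RtoC (e1 * e3 * (e1 * e2) ^ pred j) * resonator psi j s)%C).

Lemma gauge_scattering_solution (ty : vertex_type) (N : nat)
    (h l alpha beta th1 th2 th3 k e1 e2 e3 : R) (psi : graph_function) (r t : C) :
  th1 <> 0 -> th2 <> 0 -> th3 <> 0 ->
  e1 = 1 \/ e1 = -1 -> e2 = 1 \/ e2 = -1 -> e3 = 1 \/ e3 = -1 ->
  scattering_solution ty N h l alpha beta th1 th2 th3 k psi r t ->
  scattering_solution ty N h l alpha beta (e1 * th1) (e2 * th2) (e3 * th3) k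
    (gauge e1 e2 e3 psi) r (RtoC ((e1 * e2) ^ N) * t).
Proof.
intros T1 T2 T3 S1 S2 S3 (Hc & Hr & Hv & Hu & Hin & Hout).
split; [|split; [|split; [|split; [|split]]]]; simpl.
- intros j Hj; apply helmholtz_scale, Hc, Hj.
- intros j Hj; apply helmholtz_scale, Hr, Hj.
- intros j Hj; destruct (Hv j Hj) as (p1 & p2 & p3 & d1 & d2 & d3 & B1 & B2 & B3 & V).
  set (m := (e1 * e2) ^ pred j).
  assert (F2 : (e1 * e2) ^ j = e1 * m * e2).
  { replace j with (S (pred j)) at 1 by lia; unfold m; simpl; ring. }
  (* The factor of the left edge is [m]; it is [e1] times the common sign
     [e1 * m] only because [e1 * e1 = 1]. *)
  assert (F1 : m = e1 * m * e1).
  { transitivity (e1 * e1 * m); [rewrite sign_square by exact S1; ring | ring]. }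
  assert (F3 : e1 * e3 * m = e1 * m * e3) by ring.
  apply (vertex_condition_signs _ _ _ _ e1 e2 e3) in V; try assumption.
  apply (vertex_condition_scale _ _ _ _ _ _ _ _ _ _ (RtoC (e1 * m))) in V.
  rewrite !Cmult_assoc, <- !RtoC_mult, <- F1, <- F2, <- F3 in V.
  do 6 eexists; split; [|split; [|split; [|exact V]]];
    apply boundary_values_scale; assumption.
- intros j Hj; destruct (Hu j Hj) as (p & d & B & E).
  set (m := e1 * e3 * (e1 * e2) ^ pred j).
  exists (RtoC m * p)%C, (RtoC m * d)%C; split;
    [now apply boundary_values_scale|].
  transitivity (RtoC m * (RtoC alpha * p + RtoC beta * - d))%C; [ring|].
  rewrite E; ring.
- intros x Hx; rewrite (Hin x Hx); ring.
- intros x Hx; rewrite (Hout x Hx); ring.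
Qed.

Theorem mainTheorem9 :
  forall (ty : vertex_type) (N : nat) (h l alpha beta th1 th2 th3 : R),
    (1 <= N)%nat -> 0 < h -> 0 < l ->
    (alpha, beta) <> (0, 0) ->
    th1 * th2 * th3 <> 0 ->
    forall k : R, 0 < k ->
    forall e1 e2 e3 : R,
      (e1 = 1 \/ e1 = -1) -> (e2 = 1 \/ e2 = -1) -> (e3 = 1 \/ e3 = -1) ->
      transmission_probability ty N h l alpha beta
        (e1 * th1) (e2 * th2) (e3 * th3) k
      = transmission_probability ty N h l alpha beta th1 th2 th3 k.
Proof.
intros ty N h l alpha beta th1 th2 th3 HN Hh Hl Hab Hth k Hk e1 e2 e3 S1 S2 S3.
assert (T1 : th1 <> 0) by (intros E; apply Hth; rewrite E; ring).
assert (T2 : th2 <> 0) by (intros E; apply Hth; rewrite E; ring).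
assert (T3 : th3 <> 0) by (intros E; apply Hth; rewrite E; ring).
assert (Hth' : e1 * th1 * (e2 * th2) * (e3 * th3) <> 0).
{ repeat apply Rmult_integral_contrapositive_currified; try assumption;
    [destruct S1 | destruct S2 | destruct S3]; lra. }
destruct (transmission_amplitude_spec ty N h l alpha beta th1 th2 th3 k
  HN Hh Hl Hab Hth Hk) as (psi & r & Hpsi).
apply (gauge_scattering_solution _ _ _ _ _ _ _ _ _ _ e1 e2 e3) in Hpsi;
  try assumption.
unfold transmission_probability.
rewrite (transmission_amplitude_unique ty N h l alpha beta
  (e1 * th1) (e2 * th2) (e3 * th3) k
  (transmission_amplitude ty N h l alpha beta (e1 * th1) (e2 * th2) (e3 * th3) k)
  (RtoC ((e1 * e2) ^ N) * transmission_amplitude ty N h l alpha beta th1 th2 th3 k)%C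
  Hh Hl Hab Hth' Hk);
  [|now apply transmission_amplitude_spec | now exists (gauge e1 e2 e3 psi), r].
rewrite Cmod_mult, Cmod_R, <- RPow_abs.
replace (Rabs (e1 * e2)) with 1.
- rewrite pow1; ring.
- destruct S1 as [-> | ->], S2 as [-> | ->]; rewrite Rabs_mult, ?Rabs_Ropp;
    unfold Rabs; repeat destruct Rcase_abs; lra.
Qed.
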